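(* Let $\lambda>0$ and let $\mathcal{A}$ be a $\lambda$-decentralized sortition algorithm on a set $[N]$ of participants with weights $w_1,\dots,w_N$. If the adversary controls a set $A\subseteq[N]$ of participants with $\sum_{n\in A} w_n\le \frac{\lambda}{2}$, then the adversary cannot get a majority of the total voting power; that is, for every committee realization $\mathcal{M}$, $\sum_{n\in A} g(n;\mathcal{M})\le \frac12$.
   Context: Setting: there are $N$ participants, indexed by $[N]=\{1,\dots,N\}$, with positive weights $w_1,\dots,w_N$ satisfying $\sum_{n=1}^N w_n=1$. A sortition algorithm takes $\vec w=(w_1,\dots,w_N)^T$ and outputs a random committee $\mathcal{M}=\{m_1,\dots,m_M\}\subseteq[N]$ of fixed size $M$ together with voting powers $g(n;\mathcal{M})\ge 0$ which are normalized, $\sum_{m\in\mathcal{M}}g(m;\mathcal{M})=1$, and satisfy $g(n;\mathcal{M})=0$ for $n\notin\mathcal{M}$. For $\lambda>0$, the algorithm is called $\lambda$-decentralized if for every committee realization $\mathcal{M}$ (every committee that can be output), $\max_{m\in\mathcal{M}} \frac{g(m;\mathcal{M})}{w_m}\le\frac1\lambda$. A majority means strictly more than $1/2$ of the total voting power. *)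

(* Defs.v *)
From mathcomp Require Import all_boot all_order all_algebra.
From mathcomp Require Import reals.
Set Implicit Arguments.
Unset Strict Implicit.
Unset Printing Implicit Defensive.
Import Order.TTheory GRing.Theory Num.Theory.
Local Open Scope ring_scope.

Record weights (R : realType) (N : nat) := Weights {
  weight :> 'I_N -> R;
  weight_gt0 : forall n, 0 < weight n;
  weight_sum1 : \sum_n weight n = 1 }.

(* The law of the random committee is its probability mass function on the    *)
(* subsets of the participants; a committee can be output when its mass is    *)
(* positive. The axioms on the voting powers only concern those committees.   *)
Record outcome (R : realType) (N M : nat) := Outcome {
  committee_prob : {set 'I_N} -> R;
  voting_power : 'I_N -> {set 'I_N} -> R;
  committee_prob_ge0 : forall C, 0 <= committee_prob C;
  committee_prob_sum1 : \sum_C committee_prob C = 1;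
  committee_size : forall C, 0 < committee_prob C -> #|C| = M;
  voting_power_ge0 : forall C, 0 < committee_prob C ->
    forall n, 0 <= voting_power n C;
  voting_power_sum1 : forall C, 0 < committee_prob C ->
    \sum_(m in C) voting_power m C = 1;
  voting_power_out : forall C, 0 < committee_prob C ->
    forall n, n \notin C -> voting_power n C = 0 }.

Definition realization (R : realType) (N M : nat) (o : outcome R N M)
  (C : {set 'I_N}) : Prop := 0 < committee_prob o C.

Definition sortition (R : realType) (N M : nat) : Type :=
  weights R N -> outcome R N M.

(* The ratios are nonnegative on realizations, so starting the maximum at 0   *)
(* does not change its value; realizations are nonempty by normalization.     *)
Definition decentralized (R : realType) (N M : nat) (lambda : R)
  (A : sortition R N M) (w : weights R N) : Prop :=
  forall C, realization (A w) C ->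
    \big[Num.max/0]_(m in C) (voting_power (A w) m C / w m) <= 1 / lambda.

(* Main.v *)
Require Import Defs.
From mathcomp Require Import all_boot all_order all_algebra.
From mathcomp Require Import reals.
Import Order.TTheory GRing.Theory Num.Theory.
Local Open Scope ring_scope.

(** Decentralization caps the ratio of power to weight on the committee, and power vanishes off it,
    so on a realization every participant has power at most [w n / lambda] ([voting_power_le]).
    Summing over [Adv] gives at most [(lambda / 2) / lambda = 1 / 2]. *)

Lemma voting_power_le (R : realType) (N M : nat) (lambda : R)
  (w : weights R N) (A : sortition R N M) (C : {set 'I_N}) (n : 'I_N) :
  0 < lambda -> decentralized lambda A w -> realization (A w) C ->
  voting_power (A w) n C <= w n / lambda.
Proof.
move=> lambda_gt0 decA realC; have wn_gt0 := weight_gt0 w n.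
have [nC|nC] := boolP (n \in C).
  (* For a member of [C], the ratio is one of the terms of the maximum that [decA] bounds. *)
  rewrite mulrC -ler_pdivrMr // -[lambda^-1]mul1r.
  apply: le_trans (decA C realC).
  exact: (le_bigmax_cond _ (fun m => voting_power (A w) m C / w m)).
by rewrite (voting_power_out realC nC) divr_ge0 ?ltW.
Qed.

Theorem proposition3p1 (R : realType) (N M : nat) (lambda : R)
  (w : weights R N) (A : sortition R N M) (Adv : {set 'I_N}) :
  0 < lambda ->
  decentralized lambda A w ->
  \sum_(n in Adv) w n <= lambda / 2 ->
  forall C : {set 'I_N}, realization (A w) C ->
    \sum_(n in Adv) voting_power (A w) n C <= 1 / 2.
Proof.
move=> lambda_gt0 decA wAdv C realC.
apply: (@le_trans _ _ (\sum_(n in Adv) w n / lambda)).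
  by apply: ler_sum => n _; apply: voting_power_le.
(* Clearing the common factor [lambda^-1] leaves exactly [wAdv]. *)
by rewrite -mulr_suml ler_pdivrMr // mulrAC mul1r.
Qed.
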